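(* Let $k\ge 0$ be an integer and let $H$ be a linear subspace of $\Omega^1(G)$ such that $H\subseteq\operatorname{im} d$ and $\dim H=|V|-1-k$. Let $c_1,\dots,c_k\in\Omega_1(G)$ be such that $$H=\{\alpha\in\operatorname{im} d:(\alpha,c_1)=\dots=(\alpha,c_k)=0\},$$ and set $\mathsf c=c_1\wedge\dots\wedge c_k$. Let $X$ be a determinantal random subset of $E^+$ (identified with a random subgraph of $G$) associated to $H$ in the orthonormal basis $(e^\star/\sqrt{x_e})_{e\in E^+}$ of $\Omega^1(G)$. Then $X$ belongs to $\mathcal F_k(G)$ almost surely and, for every $F\in\mathcal F_k(G)$, $$\mathbb P(X=F)=\frac{|(\det\mathscr B^F,\mathsf c)|^2\,\underline x^F}{A_k(\mathsf c,\underline x)},\qquad\text{where } A_k(\mathsf c,\underline x)=\sum_{F'\in\mathcal F_k(G)}|(\det\mathscr B^{F'},\mathsf c)|^2\,\underline x^{F'}.$$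
   Context: Let $\mathbb K=\mathbb R$ or $\mathbb C$. $G=(V,E)$ is a finite connected graph: $V$ is a finite set of vertices and $E$ a finite set of oriented edges, with source and target maps $s,t:E\to V$ and a fixed-point-free involution $e\mapsto e^{-1}$ of $E$ exchanging source and target. $E^+\subset E$ is a fixed subset containing exactly one element of each pair $\{e,e^{-1}\}$, with a fixed total order. Positive weights $\underline x=(x_e)_{e\in E}$ with $x_{e^{-1}}=x_e$ are given, and $\underline x^A=\prod_{e\in (A\cup A^{-1})\cap E^+}x_e$ for $A\subseteq E$. A subgraph of $G$ is a subset $S\subseteq E$ stable under $e\mapsto e^{-1}$, seen as the graph $(V,S)$ (all subgraphs are spanning); it is identified with $S\cap E^+$. $\mathcal F_k(G)$ is the set of acyclic subgraphs (spanning forests) with $k+1$ connected components (isolated vertices count as components). $C_1(G)$ is the free abelian group on $E$ modulo $e+e^{-1}=0$; $C^0(G)$ is the group of functions $V\to\mathbb Z$; $C^1(G)=\mathrm{Hom}(C_1(G),\mathbb Z)$, with basis $(e^\star)_{e\in E^+}$ dual to $E^+$; $\delta:C^0(G)\to C^1(G)$, $\delta f(e)=f(t(e))-f(s(e))$; $B^1(G)=\operatorname{im}\delta$. For a subgraph $F$, $B^1(G,F)$ is the group of elements of $B^1(G)$ vanishing on all edges of $F$. Set $\Omega_1(G)=C_1(G)\otimes\mathbb K$, $\Omega^i(G)=C^i(G)\otimes\mathbb K$, $d=\delta\otimes\mathrm{id}_{\mathbb K}$; $(\alpha,c)=\alpha(c)$ is the ($\mathbb K$-bilinear) pairing of $\Omega^1(G)$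 with $\Omega_1(G)$. $\Omega^1(G)$ carries the inner product $\langle\alpha,\beta\rangle=\sum_{e\in E^+}x_e\overline{\alpha(e)}\beta(e)$. For $F\in\mathcal F_k(G)$, $\mathscr B^F=(\beta_1,\dots,\beta_k)$ is any $\mathbb Z$-basis of the rank $k$ free group $B^1(G,F)$, $\det\mathscr B^F=\beta_1\wedge\dots\wedge\beta_k$ (well defined up to sign), and $|(\det\mathscr B^F,\mathsf c)|^2=|\det(\beta_i(c_j))_{1\le i,j\le k}|^2$. Given a finite-dimensional inner product space with an orthonormal basis indexed by a finite set $S$ and a subspace $H$, a random subset $X$ of $S$ is determinantal associated to $H$ in this basis if $\mathbb P(J\subseteq X)=\det((\Pi^H)^J_J)$ for all $J\subseteq S$, where $\Pi^H$ is the orthogonal projection on $H$ and $(\Pi^H)^J_J$ is the submatrix of its matrix in the basis with rows and columns in $J$. *)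

(* Defs.v *)
From HB Require Import structures.
From mathcomp Require Import all_boot all_order all_algebra.
From mathcomp Require Import complex.
From mathcomp Require Import all_classical all_reals all_analysis.
Set Implicit Arguments.
Unset Strict Implicit.
Unset Printing Implicit Defensive.
Import Order.TTheory GRing.Theory Num.Theory.
Local Open Scope ring_scope.

Variant scalar_kind := RealScalars | ComplexScalars.

Section Scalars.
Variable R : realType.

Definition scalars (s : scalar_kind) : numFieldType :=
  match s with RealScalars => R | ComplexScalars => R[i]%C end.

Definition of_real (s : scalar_kind) : R -> scalars s :=
  match s with
  | RealScalars => fun a => a
  | ComplexScalars => fun a => real_complex R a
  end.

Definition conj_scalar (s : scalar_kind) : scalars s -> scalars s :=
  match s with
  | RealScalars => fun z => z
  | ComplexScalars => fun z => conjc z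
  end.

(* The modulus as an element of R; on R[i] the generic norm `|z| has values
   in R[i]. *)
Definition modulus (s : scalar_kind) : scalars s -> R :=
  match s with
  | RealScalars => fun z : R => `|z|
  | ComplexScalars => fun z : R[i]%C => ComplexField.Normc.normc z
  end.

End Scalars.

(* Loops and multiple edges are allowed. *)
Record graph := Graph {
  vert : finType;
  edge : finType;
  src : edge -> vert;
  tgt : edge -> vert;
  einv : edge -> edge;
  einvK : involutive einv;
  einv_neq : forall e, einv e != e;
  src_einv : forall e, src (einv e) = tgt e;
  tgt_einv : forall e, tgt (einv e) = src e }.

Section Graphs.
Variable G : graph.
Local Notation V := (vert G).
Local Notation E := (edge G).

(* E^+ contains exactly one element of each pair {e, e^-1}. *)
Definition orientation (Ep : {set E}) : Prop :=
  forall e, (einv e \in Ep) = (e \notin Ep).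

Definition symmetrize (A : {set E}) : {set E} := A :|: [set einv e | e in A].

Definition is_subgraph (S : {set E}) : bool := [forall e in S, einv e \in S].

Definition adjacent (S : {set E}) : rel V :=
  fun u v => [exists e in S, (src e == u) && (tgt e == v)].

(* The relation [adjacent S] is symmetric when S is a subgraph. *)
Definition num_components (S : {set E}) : nat := n_comp (adjacent S) predT.

Definition connected_graph : Prop := num_components [set: E] = 1%N.

(* Consecutive edges of a cycle are not inverse to each other and its vertices
   are distinct; a loop is a cycle of length 1, and two parallel edges give a
   cycle of length 2. *)
Definition is_cycle (p : seq E) : bool :=
  [&& p != [::],
      cycle (fun e f : E => (tgt e == src f) && (f != einv e)) p
    & uniq [seq src e | e <- p]].

Definition acyclic (S : {set E}) : Prop :=
  forall p : seq E, {subset p <= S} -> ~~ is_cycle p.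

Definition forests (k : nat) : {set {set E}} :=
  [set S | [&& is_subgraph S, `[< acyclic S >]
             & num_components S == k.+1]].

Definition coboundary (A : zmodType) (f : {ffun V -> A}) : {ffun E -> A} :=
  [ffun e => f (tgt e) - f (src e)].

(* B^1(G, F).  A homomorphism from C_1(G) is a function a on E, here with
   a (einv e) = - a e holding automatically for coboundaries. *)
Definition B1rel (F : {set E}) (a : {ffun E -> int}) : Prop :=
  (exists f : {ffun V -> int}, a = coboundary f) /\
  (forall e, e \in F -> a e = 0).

Definition is_Zbasis (k : nat) (B : {ffun E -> int} -> Prop)
    (b : 'I_k -> {ffun E -> int}) : Prop :=
  (forall i, B (b i)) /\
  (forall a, B a ->
     exists! n : {ffun 'I_k -> int}, a = \sum_(i < k) b i *~ n i).

Section Forms.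
Variables (R : realType) (s : scalar_kind).
Local Notation K := (scalars R s).

(* Omega^1(G) = Hom(C_1(G), K) is the subspace [Omega1] of antisymmetric
   elements of [cochain]. *)
Definition cochain : vectType K := {ffun E -> K^o}.

(* A chain is a formal sum of edges representing its class in Omega_1(G),
   the quotient by the relations e + e^-1 = 0; the pairing of an element of
   [Omega1] with a chain depends only on that class (see [pairing_rel]). *)
Definition chain := {ffun E -> K}.

Definition ext_d (f : {ffun V -> K^o}) : cochain := coboundary f.

Fact ext_d_is_linear : linear ext_d.
Proof.
move=> a f g; apply/ffunP => e; rewrite !ffunE /=.
by rewrite scalerBr opprD addrACA.
Qed.

HB.instance Definition _ :=
  GRing.isLinear.Build K {ffun V -> K^o} cochain _ ext_d ext_d_is_linear.

Definition im_d : {vspace cochain} := limg (linfun ext_d).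

Definition Omega1 (a : cochain) : Prop := forall e, a (einv e) = - a e.

Definition pairing (a : cochain) (c : chain) : K := \sum_(e : E) c e * a e.

Lemma pairing_rel (a : cochain) (e : E) (c : chain) : Omega1 a ->
  pairing a [ffun f => c f + (f == e)%:R + (f == einv e)%:R] = pairing a c.
Proof.
move=> ha; rewrite /pairing.
under eq_bigr do rewrite ffunE !mulrDl.
rewrite !big_split /= -!addrA; set u := (X in _ + X).
suff -> : u = 0 by rewrite addr0.
rewrite {}/u (bigD1 e) //= eqxx mul1r big1 ?addr0; last first.
  by move=> f /negPf ->; rewrite mul0r.
rewrite (bigD1 (einv e)) //= eqxx mul1r big1 ?addr0; last first.
  by move=> f /negPf ->; rewrite mul0r.
by rewrite ha subrr.
Qed.

Definition extend_scalars (a : {ffun E -> int}) : cochain :=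
  [ffun e => (a e)%:~R].

(* |(det b, c)|^2 with det b = b_1 /\ ... /\ b_k and c = c_1 /\ ... /\ c_k. *)
Definition sq_det_pairing (k : nat) (b : 'I_k -> {ffun E -> int})
    (c : 'I_k -> chain) : R :=
  modulus (\det (\matrix_(i < k, j < k) pairing (extend_scalars (b i)) (c j)))
    ^+ 2.

Variables (Ep : {set E}) (x : E -> R).

Definition weight (A : {set E}) : R := \prod_(e in symmetrize A :&: Ep) x e.

Definition A_poly (k : nat) (b : {set E} -> 'I_k -> {ffun E -> int})
    (c : 'I_k -> chain) : R :=
  \sum_(F in forests k) sq_det_pairing (b F) c * weight F.

Definition inner (a b : cochain) : K :=
  \sum_(e in Ep) of_real s (x e) * conj_scalar (a e) * b e.

(* e^star / sqrt(x_e) *)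
Definition onb (e : E) : cochain :=
  [ffun f => ((f == e)%:R - (f == einv e)%:R) / of_real s (Num.sqrt (x e))].

Definition is_orthogonal_projection (H : {vspace cochain})
    (Pi : 'End(cochain)) : Prop :=
  forall a, Omega1 a ->
    Pi a \in H /\ forall h, h \in H -> inner h (a - Pi a) = 0.

Definition principal_minor (Pi : 'End(cochain)) (J : {set E}) : K :=
  \det (\matrix_(i < #|J|, j < #|J|)
          inner (onb (enum_val i)) (Pi (onb (enum_val j)))).

End Forms.

Section RandomSubsets.
Variables (R : realType) (dT : measure_display) (T : measurableType dT).

Definition random_subset (Ep : {set E}) (X : T -> {set E}) : Prop :=
  (forall w, X w \subset Ep) /\
  (forall A : {set E}, measurable [set w : T | X w = A]%classic).

Definition determinantal (s : scalar_kind) (Ep : {set E}) (x : E -> R)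
    (H : {vspace cochain R s}) (P : probability T R) (X : T -> {set E}) : Prop :=
  random_subset Ep X /\
  exists2 Pi : 'End(cochain R s), is_orthogonal_projection Ep x H Pi &
    forall J : {set E}, J \subset Ep ->
      of_real s (fine (P [set w | J \subset X w]%classic)) = principal_minor Ep x Pi J.

End RandomSubsets.
End Graphs.

(* Main.v *)
From HB Require Import structures.
Require Import Defs.
From mathcomp Require Import all_boot all_order all_algebra.
From mathcomp Require Import complex.
From mathcomp Require Import all_classical all_reals all_analysis.
Set Implicit Arguments.
Unset Strict Implicit.
Unset Printing Implicit Defensive.
Import Order.TTheory GRing.Theory Num.Theory.
Local Open Scope ring_scope.

(** Let r = dim H, let al be a basis of H and let J be a set of r edges of E^+.
    The minor of the projection indexed by J is a constant times
    x^J |det (al_l(e))_(l, e in J)|^2.  Consider the r + 1 + k linear forms on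
    0-cochains given by the values of df on the edges of J, the value of f at a
    base vertex, and the pairings (df, c_j).  In a fixed basis of K^V extending
    potentials of al, their determinant is a constant times
    det (al_l(e)); if J spans a forest F, then in the Z-basis made of functions
    dual to the edges of F, the constant 1 and potentials of B^F, it is
    det (B^F, c).  Since the latter basis is a Z-basis of Z^V, the determinant
    of the change of basis does not depend on F up to sign, so that P(X = F) is
    proportional to |(det B^F, c)|^2 x^F.
    Conversely, if the forms are linearly independent then so are the edges of J,
    which therefore spans a forest, and this forest has k + 1 components by counting
    dimensions.  Finally |X| <= r almost surely because the projection has rank
    r, and E|X| = r is its trace, so |X| = r almost surely, which determines the
    constant. *)

(** * Forests and cycles *)

Section GraphFacts.
Variable G : graph.
Local Notation V := (vert G).
Local Notation E := (edge G).
Implicit Types (S F J Ep : {set E}) (e : E).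

Lemma einv_in_subgraph S e : is_subgraph S -> (einv e \in S) = (e \in S).
Proof.
move=> /'forall_implyP hS; apply/idP/idP => [/hS|/hS//].
by rewrite einvK.
Qed.

Lemma in_symmetrize J e : (e \in symmetrize J) = (e \in J) || (einv e \in J).
Proof.
rewrite inE; congr (_ || _); apply/imsetP/idP => [[f fJ ->]|eJ].
  by rewrite einvK.
by exists (einv e) => //; rewrite einvK.
Qed.

Lemma symmetrize_subgraph J : is_subgraph (symmetrize J).
Proof.
apply/'forall_implyP => e; rewrite !in_symmetrize einvK.
by rewrite orbC.
Qed.

Lemma symmetrize_id S : is_subgraph S -> symmetrize S = S.
Proof.
by move=> hS; apply/setP => e; rewrite in_symmetrize einv_in_subgraph // orbb.
Qed.

Section Orientation.
Variables (Ep : {set E}) (Ep_orientation : orientation Ep).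

Lemma symmetrizeK J : J \subset Ep -> symmetrize J :&: Ep = J.
Proof.
move=> JE; apply/setP => e; rewrite inE in_symmetrize.
apply/andP/idP => [[/orP[//|eJ] eE]|eJ].
  by have := fintype.subsetP JE _ eJ; rewrite Ep_orientation eE.
by rewrite eJ (fintype.subsetP JE).
Qed.

Lemma symmetrize_setI S : is_subgraph S -> symmetrize (S :&: Ep) = S.
Proof.
move=> hS; apply/setP => e; rewrite in_symmetrize !inE einv_in_subgraph //.
by rewrite Ep_orientation -andb_orr orbN andbT.
Qed.

End Orientation.

Lemma adjacent_connect_sym S : is_subgraph S -> connect_sym (Defs.adjacent S).
Proof.
move=> hS; apply: sym_connect_sym; apply: symmetric_from_pre => u v.
move=> /existsP[e /andP[eS /andP[/eqP su /eqP tv]]].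
apply/existsP; exists (einv e).
by rewrite einv_in_subgraph // eS src_einv tgt_einv su tv !eqxx.
Qed.

Lemma constant_on_components (T : Type) S (f : V -> T) :
  (forall e, e \in S -> f (tgt e) = f (src e)) ->
  forall u v, connect (Defs.adjacent S) u v -> f u = f v.
Proof.
move=> hf u v /connectP[p]; elim: p u => [|w p IH] u /= => [_ -> //|].
case/andP=> /existsP[e /andP[eS /andP[/eqP <- /eqP <-]]] hp hv.
by rewrite -hf // (IH _ hp hv).
Qed.

Lemma constant_of_connected (T : Type) (f : V -> T) : connected_graph G ->
  (forall e, f (tgt e) = f (src e)) -> forall u v, f u = f v.
Proof.
move=> hG hf u v; apply: (@constant_on_components T [set: E]) => //.
have hs : connect_sym (Defs.adjacent [set: E]).
  by apply: adjacent_connect_sym; apply/'forall_implyP => e; rewrite !inE.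
rewrite -(root_connect hs); move: hG; rewrite /connected_graph /num_components.
rewrite /n_comp_mem => /eqP /card1P[r hr].
have hv w : fingraph.root (Defs.adjacent [set: E]) w = r.
  have := hr (fingraph.root (Defs.adjacent [set: E]) w).
  by rewrite !inE roots_root // => /esym /eqP.
by rewrite !hv.
Qed.

(* Distinct vertices prevent backtracking. *)
Lemma edge_path_of_adjacent S u p :
  path (Defs.adjacent S) u p -> uniq (u :: p) ->
  exists q : seq E, [/\ {subset q <= S}, [seq tgt e | e <- q] = p,
    [seq src e | e <- q] = belast u p
    & sorted (fun e f : E => (tgt e == src f) && (f != einv e)) q].
Proof.
elim: p u => [|v p IH] u; first by exists [::].
move=> /= /andP[/existsP[e /andP[eS /andP[/eqP su /eqP tv]]] hp].
move=> /andP[uvp vp].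
have [q [qS qt qs hq]] := IH v hp vp.
exists (e :: q); split => /=.
- by move=> f; rewrite inE => /predU1P[->//|/qS].
- by rewrite qt tv.
- by rewrite qs su.
case: q qS qt qs hq => [//|f q] qS qt qs /= ->; rewrite andbT.
case: p {IH} uvp hp vp qt qs => [//|w p] uvp hp vp /= [tw _] [sf _].
rewrite tv sf eqxx /=; apply: contraNneq uvp => fe.
by rewrite -su -tgt_einv -fe tw !inE eqxx orbT.
Qed.

(** A path from the target of [e] back to its source avoiding [e] and its inverse can be made
    simple, and [e] then closes it into a cycle. *)
Lemma acyclic_not_connected S e : is_subgraph S -> acyclic S -> e \in S ->
  ~~ connect (Defs.adjacent (S :\: [set e; einv e])) (tgt e) (src e).
Proof.
move=> hS aS eS; apply/negP => /connectP[p hp hl].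
case: (shortenP hp) hl => {hp} p' hp up _ hl.
have [q [qS qt qs hq]] := edge_path_of_adjacent hp up.
suff: is_cycle (e :: q).
  apply/negP; apply: aS => f; rewrite inE => /predU1P[->//|/qS].
  by rewrite inE => /andP[].
apply/and3P; split => //=; last first.
  by rewrite qs hl -rcons_uniq -lastI.
have qe f : f \in q -> (f != e) && (f != einv e).
  by move=> /qS; rewrite !inE => /andP[]; rewrite negb_or.
rewrite rcons_path; case: q qS qt qs hq qe => [|f q] qS qt qs hq qe /=.
  (* The empty path: [e] is a loop, a cycle of length one. *)
  by case: p' hp up hl qt qs => // _ _ -> _ _; rewrite eqxx eq_sym einv_neq.
case: p' hp up hl qt qs => [//|w p'] hp up hl [tw qt] [sf qs].
rewrite sf eqxx /=; have /andP[_ ->] := qe f (mem_head _ _).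
rewrite [path _ _ _]hq /=; apply/andP; split.
  by rewrite hl -tw /= -qt last_map.
have /qe/andP[_ h] := mem_last f q.
by apply: contraNneq h => ->; rewrite einvK.
Qed.

(** The function is the indicator of the component of [tgt e] once [e] and its inverse are deleted,
    that is, a fundamental cut. Its boolean values can be read in any ring. *)
Lemma acyclic_dual S e : is_subgraph S -> acyclic S -> e \in S ->
  exists f : V -> bool, [/\ f (tgt e) = true, f (src e) = false
    & forall e', e' \in S -> e' != e -> e' != einv e -> f (tgt e') = f (src e')].
Proof.
move=> hS aS eS; have hn := acyclic_not_connected hS aS eS.
set S' := S :\: _ in hn.
have hS' : is_subgraph S'.
  apply/'forall_implyP => f; rewrite !inE !negb_or => /andP[/andP[fe fe'] fS].
  by rewrite einv_in_subgraph // fS andbT (can2_eq (@einvK G) (@einvK G)) fe'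
    (inj_eq (can_inj (@einvK G))).
exists (connect (Defs.adjacent S') (tgt e)); split.
- exact: connect0.
- exact: negbTE.
move=> f fS fe fe'; apply/esym; apply: same_connect_r.
  exact: adjacent_connect_sym.
apply: connect1; apply/existsP; exists f.
by rewrite !inE negb_or fe fe' fS !eqxx.
Qed.

Lemma uniq_map_inj (T T' : eqType) (f : T -> T') (p : seq T) :
  uniq (map f p) -> {in p &, injective f}.
Proof.
elim: p => [//|a p IH] /= /andP[ap /IH hp] u v.
rewrite !inE => /predU1P[->|up] /predU1P[->|vp] // h; last exact: hp.
- by case/negP: ap; rewrite h map_f.
- by case/negP: ap; rewrite -h map_f.
Qed.

(** The edge following [e] starts at [tgt e], and so does [einv e]; distinct sources would make them
    equal, which is backtracking. *)
Lemma cycle_einv p e : is_cycle p -> e \in p -> einv e \notin p.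
Proof.
move=> /and3P[_ hc hu] ep; apply/negP => ep'.
have /andP[/eqP h1 /negP[]] := next_cycle hc ep.
have hn : next p e \in p by rewrite mem_next.
have := uniq_map_inj hu hn ep'.
by rewrite src_einv => ->.
Qed.

Lemma cycle_sum (A : zmodType) (f : V -> A) p : is_cycle p ->
  \sum_(e <- p) (f (tgt e) - f (src e)) = 0.
Proof.
move=> /and3P[_ hc _]; case: p hc => [|e p /= hp]; first by rewrite big_nil.
rewrite -[X in _ = X](subrr (f (src e))).
have -> : f (src e) - f (src e) = f (src (last e (rcons p e))) - f (src e).
  by rewrite last_rcons.
have : path (fun e f : E => tgt e == src f) e (rcons p e).
  by apply: sub_path hp => a b /andP[].
(* The closed path is generalized to any path [q] from [e], so that the sum over [belast e q]
   telescopes by induction. *)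
rewrite -[in LHS](belast_rcons e p e) /=.
move: (rcons p e) => q {hp}; elim: q e => [|a q IH] e0 /=; first by rewrite big_nil subrr.
move=> /andP[/eqP h /IH hq]; rewrite big_cons hq h.
by rewrite addrC subrKA.
Qed.

(** On a cycle through [e] the coboundary of [f] sums to zero, yet [e] alone contributes, since its
    inverse is not on the cycle. *)
Lemma acyclic_of_dual S (A : nzRingType) :
  (forall e, e \in S -> exists f : V -> A, f (tgt e) - f (src e) != 0 /\
   forall e', e' \in S -> e' != e -> e' != einv e -> f (tgt e') = f (src e')) ->
  acyclic S.
Proof.
move=> hd p pS; apply/negP => hp.
have [e ep] : exists e, e \in p.
  by case/and3P: hp; case: p pS => // e p _ _ _ _; exists e; rewrite mem_head.
have [f [fe hf]] := hd e (pS _ ep).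
have up : uniq p by case/and3P: hp => _ _ /map_uniq.
have := cycle_sum f hp; rewrite (bigD1_seq e) //= big_seq_cond big1 ?addr0.
  by move=> h; rewrite h eqxx in fe.
move=> e' /andP[e'p e'e]; rewrite hf ?subrr //; first exact: pS.
by apply: contraTneq e'p => ->; exact: cycle_einv.
Qed.
End GraphFacts.

(** * The incidence matrix *)

Section Incidence.
Variables (G : graph) (N : nat) (vtx : 'I_N -> vert G) (idx : vert G -> 'I_N).
Hypotheses (vtxK : cancel vtx idx) (idxK : cancel idx vtx).
Local Notation E := (edge G).

(** 0-cochains are row vectors: multiplying them by this matrix evaluates their coboundaries on the
    edges [ed j]. It is used over both the integers and the scalars. *)
Definition incidence (A : nzRingType) m (ed : 'I_m -> E) : 'M[A]_(N, m) :=
  \matrix_(i, j) ((tgt (ed j) == vtx i)%:R - (src (ed j) == vtx i)%:R).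

Lemma sum_vtx (A : nzRingType) (f : 'I_N -> A) v :
  \sum_i f i * (v == vtx i)%:R = f (idx v).
Proof.
rewrite (bigD1 (idx v)) //= idxK eqxx mulr1 big1 ?addr0 // => i hi.
by rewrite -(can2_eq vtxK idxK) eq_sym in hi; rewrite (negPf hi) mulr0.
Qed.

Lemma mul_incidence (A : nzRingType) m (ed : 'I_m -> E) p (f : 'M[A]_(p, N)) i j :
  (f *m incidence A ed) i j = f i (idx (tgt (ed j))) - f i (idx (src (ed j))).
Proof.
rewrite mxE; under eq_bigr do rewrite mxE mulrBr.
by rewrite sumrB !sum_vtx.
Qed.

Section Rank.
Variables (m : nat) (ed : 'I_m -> E).
Let S := symmetrize [set ed j | j : 'I_m].

(** The left kernel is the space of functions constant on each component of [S]. *)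
Lemma rank_incidence (K : fieldType) :
  (\rank (incidence K ed) + num_components S)%N = N.
Proof.
have hs : connect_sym (Defs.adjacent S).
  exact/adjacent_connect_sym/symmetrize_subgraph.
pose rt := fingraph.root (Defs.adjacent S).
pose rts := [pred v | v \in roots (Defs.adjacent S)].
have -> : num_components S = #|rts|.
  by apply: eq_card => v; rewrite !inE andbT.
(* The rows of [B] are the indicators of the components, and [Z] evaluates at their roots;
   [B *m Z = 1] makes these indicators independent. *)
pose B : 'M[K]_(#|rts|, N) := \matrix_(p, i) (rt (vtx i) == enum_val p)%:R.
pose Z : 'M[K]_(N, #|rts|) := \matrix_(i, p) (enum_val p == vtx i)%:R.
have BZ : B *m Z = 1%:M.
  apply/matrixP => p q; rewrite !mxE.
  under eq_bigr do rewrite !mxE.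
  rewrite (sum_vtx (fun i => (rt (vtx i) == enum_val p)%:R)) idxK.
  have /eqP -> : rt (enum_val q) == enum_val q.
    by have := enum_valP q; rewrite !inE.
  by rewrite (inj_eq enum_val_inj) eq_sym.
have inS j : ed j \in S by rewrite in_symmetrize imset_f.
have kerB : (kermx (incidence K ed) == B)%MS.
  apply/andP; split; last first.
    apply/sub_kermxP/matrixP => p j; rewrite mul_incidence !mxE !idxK.
    have -> : rt (tgt (ed j)) = rt (src (ed j)).
      apply/eqP; rewrite root_connect // hs; apply: connect1.
      by apply/existsP; exists (ed j); rewrite inS !eqxx.
    by rewrite subrr.
  apply/row_subP => i; set f := row i _.
  have fI : f *m incidence K ed = 0.
    by rewrite /f -row_mul mulmx_ker row0.
  have fE e : e \in S -> f 0 (idx (tgt e)) = f 0 (idx (src e)).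
    rewrite in_symmetrize => /orP[] /imsetP[j _ h].
      by apply/eqP; rewrite -subr_eq0 h -mul_incidence fI mxE.
    apply/esym/eqP; rewrite -[e]einvK h src_einv tgt_einv.
    by rewrite -subr_eq0 -mul_incidence fI mxE.
  suff -> : f = (f *m Z) *m B by exact: submxMl.
  clearbody f; apply/rowP => l; rewrite [RHS]mxE.
  have hr : rt (vtx l) \in rts by rewrite !inE roots_root.
  rewrite (bigD1 (enum_rank_in hr (rt (vtx l)))) //= big1 ?addr0; last first.
    move=> p hp; rewrite [B _ _]mxE; case: eqP => [h|_]; last by rewrite mulr0.
    by case/eqP: hp; apply: enum_val_inj; rewrite enum_rankK_in.
  rewrite !mxE enum_rankK_in // eqxx mulr1.
  under eq_bigr do rewrite !mxE enum_rankK_in //.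
  rewrite (sum_vtx (fun i => f 0 i)) -[in LHS](vtxK l).
  apply: (constant_on_components (f := fun v => f 0 (idx v)) fE).
  exact: connect_root.
have rB : \rank B = #|rts|.
  by apply/eqP; apply/row_freeP; exists Z.
by have := mxrank_ker (incidence K ed); rewrite (eqmxP kerB) rB => ->;
  rewrite subnKC // rank_leq_row.
Qed.

(** The rows of a left inverse are vertex functions dual to the edges, as [acyclic_of_dual]
    requires. *)
Lemma incidence_linv_acyclic (A : nzRingType) (g : 'M[A]_(m, N)) :
  g *m incidence A ed = 1%:M -> acyclic S.
Proof.
move=> hg; have gE i j :
    g i (idx (tgt (ed j))) - g i (idx (src (ed j))) = (i == j)%:R.
  by rewrite -mul_incidence hg mxE.
apply: (@acyclic_of_dual _ _ A) => e eS.
have [i hi] : exists i, e = ed i \/ e = einv (ed i).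
  move: eS; rewrite in_symmetrize => /orP[] /imsetP[j _ h]; exists j.
    by left.
  by right; rewrite -h einvK.
exists (fun v => g i (idx v)); split.
  case: hi => ->; first by rewrite gE eqxx oner_eq0.
  by rewrite src_einv tgt_einv -opprB gE eqxx oppr_eq0 oner_eq0.
move=> e'; rewrite in_symmetrize => /orP[] /imsetP[j _ h] ne ne'.
  apply/eqP; rewrite h -subr_eq0 gE.
  case: (eqVneq i j) => [ij|_]; [rewrite -ij in h|exact: eqxx].
  by case: hi ne ne' => ->; rewrite h ?einvK eqxx.
move: h => /(congr1 (@einv G)); rewrite einvK => h.
apply/esym/eqP; rewrite h src_einv tgt_einv -subr_eq0 gE.
case: (eqVneq i j) => [ij|_]; [rewrite -ij in h|exact: eqxx].
by case: hi ne ne' => ->; rewrite h ?einvK eqxx.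
Qed.

Variables (Ep : {set E}) (Ep_orientation : orientation Ep).
Hypotheses (edE : forall j, ed j \in Ep) (ed_inj : injective ed).

(** The rows are the indicators of the fundamental cuts, hence exist over any ring. Injectivity and
    the orientation ensure that two different indices never give equal or inverse edges. *)
Lemma acyclic_incidence_linv (A : nzRingType) : acyclic S ->
  exists g : 'M[A]_(m, N), g *m incidence A ed = 1%:M.
Proof.
move=> aS.
have /fin_all_exists[f hf] j : exists f : vert G -> bool,
    [/\ f (tgt (ed j)) = true, f (src (ed j)) = false &
    forall e', e' \in S -> e' != ed j -> e' != einv (ed j) -> f (tgt e') = f (src e')].
  apply: acyclic_dual => //; first exact: symmetrize_subgraph.
  by rewrite in_symmetrize imset_f.
exists (\matrix_(j, i) (f j (vtx i))%:R); apply/matrixP => i j.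
rewrite mul_incidence !mxE !idxK; have [h1 h2 h3] := hf i.
have [->|ij] := eqVneq i j; first by have [-> -> _] := hf j; rewrite subr0.
rewrite h3 ?subrr //; first by rewrite in_symmetrize imset_f.
  by rewrite (inj_eq ed_inj) eq_sym.
apply/eqP => h; have := edE j; rewrite h Ep_orientation.
by rewrite edE.
Qed.

End Rank.

(** Over a field a left inverse exists exactly at full column rank; the rank formula then gives the
    number of components. *)
Lemma forests_incidence (K : fieldType) m (ed : 'I_m -> E) Ep k :
    orientation Ep -> (forall j, ed j \in Ep) -> injective ed ->
  symmetrize [set ed j | j : 'I_m] \in forests G k =
    row_full (incidence K ed) && (m + k.+1 == N)%N.
Proof.
move=> oE edE ed_inj; rewrite inE symmetrize_subgraph /=.
have hr := rank_incidence ed K.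
have -> : `[< acyclic (symmetrize [set ed j | j : 'I_m]) >] =
    row_full (incidence K ed).
  apply/asboolP/row_fullP => [/(acyclic_incidence_linv oE edE ed_inj K)//|[g hg]].
  exact: incidence_linv_acyclic hg.
apply: andb_id2l => /eqP rf; move: hr; rewrite rf => hr.
by rewrite -[X in _ = (_ == X)]hr eqn_add2l eq_sym.
Qed.

End Incidence.

(** * Minors of the orthogonal projection *)

Section ScalarFacts.
Variables (R : realType) (s : scalar_kind).
Local Notation K := (scalars R s).
Local Notation "z ^c" := (conj_scalar z).

Fact of_real_is_zmod_morphism : zmod_morphism (@of_real R s).
Proof. by case: s => // a b /=; rewrite rmorphB. Qed.

Fact of_real_is_monoid_morphism : monoid_morphism (@of_real R s).
Proof. by case: s; split => // a b /=; rewrite rmorphM. Qed.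

Fact conj_scalar_is_zmod_morphism : zmod_morphism (@conj_scalar R s).
Proof. by case: s => // a b /=; rewrite rmorphB. Qed.

Fact conj_scalar_is_monoid_morphism : monoid_morphism (@conj_scalar R s).
Proof.
case: s; first by split.
split; first exact: (rmorph1 (@conjc R)).
exact: (rmorphM (@conjc R)).
Qed.

HB.instance Definition _ :=
  GRing.isZmodMorphism.Build R K (@of_real R s) of_real_is_zmod_morphism.
HB.instance Definition _ :=
  GRing.isMonoidMorphism.Build R K (@of_real R s) of_real_is_monoid_morphism.
HB.instance Definition _ :=
  GRing.isZmodMorphism.Build K K (@conj_scalar R s) conj_scalar_is_zmod_morphism.
HB.instance Definition _ :=
  GRing.isMonoidMorphism.Build K K (@conj_scalar R s) conj_scalar_is_monoid_morphism.

Lemma conj_scalar_real (a : R) : (of_real s a)^c = of_real s a.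
Proof. by case: s => //=; rewrite oppr0. Qed.

Lemma conj_scalar_mul (z : K) : z^c * z = of_real s (modulus z ^+ 2).
Proof.
case: s z => /= z; first by rewrite -[LHS]expr2 real_normK ?num_real.
by case: z => a b; rewrite /= sqr_sqrtr ?addr_ge0 ?sqr_ge0 //; simpc;
  rewrite -!expr2 [b * a]mulrC subrr.
Qed.

Lemma modulus_sqr_eq0 (z : K) : modulus z ^+ 2 = 0 -> z = 0.
Proof.
move=> h; apply/eqP; have /eqP := conj_scalar_mul z.
by rewrite h rmorph0 mulf_eq0 fmorph_eq0 orbb.
Qed.

Lemma modulus_sqrM (y z : K) : modulus (y * z) ^+ 2 = modulus y ^+ 2 * modulus z ^+ 2.
Proof.
apply: (fmorph_inj (@of_real R s)).
by rewrite [RHS]rmorphM /= -!conj_scalar_mul rmorphM mulrACA.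
Qed.

Lemma modulus_sqr0 : modulus (0 : K) ^+ 2 = 0.
Proof.
by apply: (fmorph_inj (@of_real R s)); rewrite /= -conj_scalar_mul mulr0 rmorph0.
Qed.

End ScalarFacts.

Section Projection.
Variables (R : realType) (s : scalar_kind) (G : graph).
Local Notation E := (edge G).
Local Notation K := (scalars R s).
Local Notation "z ^c" := (conj_scalar z).
Variables (Ep : {set E}) (Ep_orientation : orientation Ep).
Variables (x : E -> R) (x_gt0 : forall e, 0 < x e).

Local Notation inner := (@Defs.inner G R s Ep x).
Local Notation onb := (onb s x).
Let w e : K := of_real s (Num.sqrt (x e)).

Let w_neq0 e : w e != 0.
Proof. by rewrite fmorph_eq0 gt_eqF ?sqrtr_gt0. Qed.

Let w_sqr e : of_real s (x e) = w e * w e.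
Proof. by rewrite -rmorphM -expr2 sqr_sqrtr // ltW. Qed.

Let w_conj e : (w e)^c = w e.
Proof. exact: conj_scalar_real. Qed.

Lemma einv_notin e : e \in Ep -> einv e \notin Ep.
Proof. by rewrite Ep_orientation negbK. Qed.

Lemma onb_Omega1 e : Omega1 (onb e).
Proof.
move=> f; rewrite !ffunE -mulNr opprB; congr (_ / _).
by rewrite (can2_eq (@einvK G) (@einvK G)) (inj_eq (can_inj (@einvK G))).
Qed.

Lemma onb_pos e f : e \in Ep -> f \in Ep -> onb e f = (f == e)%:R / w e.
Proof.
move=> eE fE; rewrite ffunE; have [->|fe] := eqVneq f e.
  by rewrite eq_sym (negPf (einv_neq e)) subr0.
have [h|_] := eqVneq f (einv e); last by rewrite subr0 !mul0r.
by have := einv_notin eE; rewrite -h fE.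
Qed.

Lemma inner_onbl e a : e \in Ep -> inner (onb e) a = w e * a e.
Proof.
move=> eE; rewrite /Defs.inner (bigD1 e) //= onb_pos // eqxx mul1r.
rewrite big1 ?addr0 => [|f /andP[fE /negPf fe]].
  by rewrite fmorphV /= w_conj w_sqr mulfK.
by rewrite onb_pos // fe mul0r rmorph0 mulr0 mul0r.
Qed.

Lemma conj_inner a a' : (inner a a')^c = inner a' a.
Proof.
rewrite /Defs.inner rmorph_sum; apply: eq_bigr => e _.
rewrite !rmorphM /= conj_scalar_real mulrAC; congr (_ * _).
suff -> : forall z : K, (z^c)^c = z by [].
by case: s => //= z; exact: conjcK.
Qed.

Lemma inner_sumr a r (t : 'I_r -> K) (al : 'I_r -> cochain G R s) :
  inner a (\sum_i t i *: al i) = \sum_i inner a (al i) * t i.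
Proof.
rewrite /Defs.inner; under [RHS]eq_bigr do rewrite mulr_suml.
rewrite exchange_big; apply: eq_bigr => e _ /=.
rewrite sum_ffunE mulr_sumr; apply: eq_bigr => i _.
by rewrite ffunE -[in RHS]mulrA; congr (_ * _); exact: mulrC.
Qed.

Lemma inner_suml a r (t : 'I_r -> K) (al : 'I_r -> cochain G R s) :
  inner (\sum_i t i *: al i) a = \sum_i (t i)^c * inner (al i) a.
Proof.
rewrite -conj_inner inner_sumr rmorph_sum; apply: eq_bigr => i _.
by rewrite rmorphM /= conj_inner mulrC.
Qed.

(** The form only sees the edges of [Ep]; antisymmetry recovers the other values. *)
Lemma inner_eq0 a : Omega1 a -> inner a a = 0 -> a = 0.
Proof.
move=> aO; rewrite /Defs.inner.
under eq_bigr do rewrite -mulrA conj_scalar_mul -rmorphM.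
rewrite -rmorph_sum => /eqP; rewrite fmorph_eq0 psumr_eq0; last first.
  by move=> e _; rewrite mulr_ge0 ?sqr_ge0 // ltW.
move=> /allP h; have a0 e : e \in Ep -> a e = 0.
  move=> eE; apply: modulus_sqr_eq0; apply/eqP.
  by have := h e (mem_index_enum e); rewrite eE mulf_eq0 gt_eqF.
apply/ffunP => e; rewrite !ffunE; have [/a0//|eE] := boolP (e \in Ep).
by rewrite -[e]einvK aO a0 ?oppr0 // Ep_orientation.
Qed.

Variables (H : {vspace cochain G R s}) (Pi : 'End(cochain G R s)).
Hypothesis H_Omega1 : forall a, a \in H -> Omega1 a.
Hypothesis Pi_proj : is_orthogonal_projection Ep x H Pi.

Variables (r : nat) (al : r.-tuple (cochain G R s)).
Hypothesis al_basis : basis_of H al.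

Definition gram : 'M[K]_r := \matrix_(l, i) inner al`_l al`_i.

Definition eval_mx m (ed : 'I_m -> E) : 'M[K]_(r, m) := \matrix_(l, j) al`_l (ed j).

Definition coord_mx m (ed : 'I_m -> E) : 'M[K]_(r, m) :=
  \matrix_(l, j) (w (ed j) * al`_l (ed j)).

Lemma basis_sum a : a \in H -> a = \sum_i coord al i a *: al`_i.
Proof. by rewrite -(span_basis al_basis) => /coord_span. Qed.

Lemma mem_al l : (l < r)%N -> al`_l \in H.
Proof.
by move=> lr; rewrite -(span_basis al_basis) memv_span // mem_nth ?size_tuple.
Qed.

(** A kernel vector yields an element of [H] orthogonal to the whole basis, hence to itself. *)
Lemma gram_unit : gram \in unitmx.
Proof.
rewrite -unitmx_tr -row_free_unit; apply: inj_row_free => u hu.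
pose h := \sum_i u 0 i *: al`_i.
have hH : h \in H by apply: memv_suml => i _; rewrite memvZ // mem_al.
have h0 : h = 0.
  apply: inner_eq0; first exact: H_Omega1.
  rewrite {1}/h inner_suml big1 // => l _.
  suff -> : inner al`_l h = (u *m gram^T) 0 l by rewrite hu mxE mulr0.
  rewrite inner_sumr mxE; apply: eq_bigr => i _.
  by rewrite !mxE mulrC.
have /freeP hf := basis_free al_basis.
by apply/rowP => i; rewrite mxE (hf _ h0).
Qed.

Definition onb_mx m (ed : 'I_m -> E) : 'M[K]_m :=
  \matrix_(i, j) inner (onb (ed i)) (Pi (onb (ed j))).

Section Edges.
Variables (m : nat) (ed : 'I_m -> E) (edE : forall j, ed j \in Ep).

(** The coordinates [T] of the projections in the basis [al], which need not be orthonormal, solve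
    the normal equations given by the Gram matrix. *)
Lemma onb_mxE : onb_mx ed =
  (coord_mx ed)^T *m invmx gram *m map_mx (@conj_scalar R s) (coord_mx ed).
Proof.
pose T := \matrix_(l < r, j < m) coord al l (Pi (onb (ed j))).
have PiE j := Pi_proj (onb_Omega1 (ed j)).
have <- : gram *m T = map_mx (@conj_scalar R s) (coord_mx ed).
  apply/matrixP => l j; rewrite !mxE; have [pH pO] := PiE j.
  transitivity (inner al`_l (Pi (onb (ed j)))).
    rewrite [in RHS](basis_sum pH) inner_sumr.
    by apply: eq_bigr => i _; rewrite !mxE.
  rewrite -(inner_onbl _ (edE j)) conj_inner.
  have /eqP := pO _ (mem_al (ltn_ord l)).
  have -> (a b b' : cochain G R s) : inner a (b - b') = inner a b - inner a b'.
    rewrite /Defs.inner -sumrB; apply: eq_bigr => e _.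
    by rewrite !ffunE mulrBr.
  by rewrite subr_eq0 => /eqP.
rewrite -mulmxA mulKmx ?gram_unit //; apply/matrixP => i j; rewrite !mxE.
rewrite inner_onbl // [in LHS](basis_sum (PiE j).1) sum_ffunE mulr_sumr.
apply: eq_bigr => l _; rewrite ffunE !mxE -mulrA; congr (_ * _).
exact: mulrC.
Qed.

(** The matrix factors through a space of dimension [r]. *)
Lemma det_onb_mx_gt : (r < m)%N -> \det (onb_mx ed) = 0.
Proof.
move=> rm; apply/eqP; apply: contraTT rm => hd.
have : row_free (onb_mx ed) by rewrite row_free_unit unitmxE unitfE.
rewrite -leqNgt => /eqP <-; rewrite onb_mxE -mulmxA.
exact: leq_trans (mxrankM_maxl _ _) (rank_leq_col _).
Qed.

(** By cyclicity the trace is that of [invmx gram] times a product of coordinate matrices, which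
    over all of [Ep] is [gram] itself. *)
Lemma trace_onb_mx : injective ed -> (forall e, e \in Ep -> exists j, e = ed j) ->
  \tr (onb_mx ed) = r%:R.
Proof.
move=> ed_inj ed_surj; rewrite onb_mxE -mulmxA mxtrace_mulC -mulmxA.
suff -> : map_mx (@conj_scalar R s) (coord_mx ed) *m (coord_mx ed)^T = gram.
  by rewrite mulVmx ?gram_unit // mxtrace1.
apply/matrixP => l i; rewrite !mxE /Defs.inner.
have -> : Ep = [set ed j | j : 'I_m].
  apply/setP => e; apply/idP/imsetP => [/ed_surj[j ->]|[j _ ->]//].
  by exists j.
rewrite big_imset /=; last by move=> ? ? _ _; exact: ed_inj.
apply: eq_bigr => j _; rewrite !mxE rmorphM /= w_conj w_sqr.
by rewrite mulrACA mulrA.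
Qed.

End Edges.

(** With [r] edges all factors of [onb_mxE] are square, so the determinant is multiplicative. *)
Lemma det_onb_mx (ed : 'I_r -> E) : (forall j, ed j \in Ep) ->
  \det (onb_mx ed) * \det gram =
    of_real s ((\prod_j x (ed j)) * modulus (\det (eval_mx ed)) ^+ 2).
Proof.
move=> edE; have gU := gram_unit; rewrite unitmxE unitfE in gU.
rewrite onb_mxE // !det_mulmx det_tr det_inv mulrAC mulfVK //.
have -> : coord_mx ed = eval_mx ed *m diag_mx (\row_j w (ed j)).
  by rewrite mul_mx_diag; apply/matrixP => l j; rewrite !mxE mulrC.
rewrite det_map_mx det_mulmx det_diag rmorphM [RHS]rmorphM /= -conj_scalar_mul.
rewrite rmorph_prod mulrACA mulrC; congr (_ * _); last exact: mulrC.
rewrite [RHS]rmorph_prod -big_split; apply: eq_bigr => j _ /=.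
by rewrite !mxE w_conj w_sqr.
Qed.

End Projection.

(** * Determinants of linear forms on 0-cochains *)

Section CutBases.
Variables (R : realType) (s : scalar_kind) (G : graph).
Local Notation E := (edge G).
Local Notation K := (scalars R s).
Hypothesis G_connected : connected_graph G.
Variables (r k : nat).
Local Notation N := (r + (1 + k))%N.
Variables (vtx : 'I_N -> vert G) (idx : vert G -> 'I_N) (v0 : vert G).
Hypotheses (vtxK : cancel vtx idx) (idxK : cancel idx vtx).
Variable c : 'I_k -> chain G R s.

Local Notation inc A ed := (incidence vtx A ed).

Definition base_mx : 'cV[K]_N := \col_i (v0 == vtx i)%:R.

Definition chain_mx : 'M[K]_(N, k) := \matrix_(i, j)
  \sum_e c j e * ((tgt e == vtx i)%:R - (src e == vtx i)%:R).

Definition form_mx (ed : 'I_r -> E) : 'M[K]_N :=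
  row_mx (inc K ed) (row_mx base_mx chain_mx).

Lemma mul_base_mx p (f : 'M[K]_(p, N)) i j : (f *m base_mx) i j = f i (idx v0).
Proof.
by rewrite mxE; under eq_bigr do rewrite mxE; rewrite (sum_vtx vtxK idxK).
Qed.

Lemma mul_chain_mx p (f : 'M[K]_(p, N)) i j : (f *m chain_mx) i j =
  \sum_e c j e * (f i (idx (tgt e)) - f i (idx (src e))).
Proof.
rewrite mxE; under eq_bigr do rewrite mxE mulr_sumr.
rewrite exchange_big; apply: eq_bigr => e _ /=.
under eq_bigr do rewrite mulrCA mulrBr.
by rewrite -mulr_sumr sumrB !(sum_vtx vtxK idxK).
Qed.

Lemma pairing_coboundary p (f : 'M[K]_(p, N)) i j :
  pairing (coboundary [ffun v => f i (idx v) : K^o]) (c j) = (f *m chain_mx) i j.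
Proof.
by rewrite mul_chain_mx; apply: eq_bigr => e _; rewrite !ffunE.
Qed.

Lemma coboundary_eq (A : nzRingType) (f g : 'rV[A]_N) :
  (forall e, f 0 (idx (tgt e)) - f 0 (idx (src e)) =
             g 0 (idx (tgt e)) - g 0 (idx (src e))) ->
  exists t, f = g + const_mx t.
Proof.
move=> h; exists (f 0 (idx v0) - g 0 (idx v0)); apply/rowP => i; rewrite !mxE.
have := @constant_of_connected G A (fun v => f 0 (idx v) - g 0 (idx v)) G_connected.
move=> /(_ _ (vtx i) v0); rewrite vtxK => <-; first by rewrite subrKC.
move=> e; have /eqP := h e; rewrite subr_eq => /eqP ->.
by rewrite addrAC [X in X + _]addrAC subrr add0r addrC.
Qed.

Section Determinants.
Variable al : r.-tuple (cochain G R s).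
Variable H : {vspace cochain G R s}.
Hypothesis al_basis : basis_of H al.
Hypothesis H_sub : (H <= im_d G R s)%VS.
Hypothesis H_eq : forall a : cochain G R s,
  a \in H <-> a \in im_d G R s /\ forall j, pairing a (c j) = 0.

Lemma im_dP (a : cochain G R s) :
  a \in im_d G R s <-> exists f : {ffun vert G -> K^o}, a = coboundary f.
Proof.
split=> [/memv_imgP[f _]|[f ->]].
  by rewrite lfunE => ->; exists f.
by apply/memv_imgP; exists f; rewrite ?memvf // lfunE.
Qed.

(** [D] is the determinant of a basis [Phi] of cochains: potentials [phi] of [al], killed by the
    last [1 + k] forms, completed by vectors [Z] dual to those forms. In this basis the matrix of
    forms is block triangular. *)
Lemma det_form_mx : exists2 D : K, D != 0 &
  forall ed, D * \det (form_mx ed) = \det (eval_mx al ed).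
Proof.
have /fin_all_exists[f hf] (l : 'I_r) :
    exists f : {ffun vert G -> K^o}, al`_l = coboundary f.
  by apply/im_dP/(subvP H_sub)/(mem_al al_basis).
(* Potentials are normalized to vanish at [v0], so that the base form kills them. *)
pose phi : 'M[K]_(r, N) := \matrix_(l, i) (f l (vtx i) - f l v0).
have phiE l e : phi l (idx (tgt e)) - phi l (idx (src e)) = al`_l e.
  by rewrite !mxE !idxK hf ffunE opprB addrA subrK.
have phi_inc ed : phi *m inc K ed = eval_mx al ed.
  by apply/matrixP => l j; rewrite (mul_incidence vtxK idxK) phiE mxE.
pose M := row_mx base_mx chain_mx.
have phiM : phi *m M = 0.
  rewrite mul_mx_row; apply/matrixP => l j; rewrite mxE [RHS]mxE.
  case: split_ordP => j' _; first by rewrite mul_base_mx mxE idxK subrr.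
  have /H_eq[_ /(_ j')] := mem_al al_basis (ltn_ord l).
  rewrite mul_chain_mx => h; rewrite -[RHS]h; apply: eq_bigr => e _.
  by rewrite phiE.
have mulphi (u : 'rV[K]_r) e :
    (u *m phi) 0 (idx (tgt e)) - (u *m phi) 0 (idx (src e)) =
    (\sum_l u 0 l *: al`_l) e.
  rewrite sum_ffunE !mxE -sumrB; apply: eq_bigr => l _.
  by rewrite ffunE -mulrBr phiE.
(* A cochain killed by [M] has its coboundary in [H], so it is a combination of the potentials plus
   a constant, which vanishes by evaluation at [v0]. *)
have kerM : (kermx M <= phi)%MS.
  apply/row_subP => i; set g := row i _.
  have gM : g *m M = 0 by rewrite -row_mul mulmx_ker row0.
  clearbody g; move: gM; rewrite mul_mx_row -row_mx0 => /eq_row_mx[gb gc].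
  have g0 : g 0 (idx v0) = 0 by rewrite -(mul_base_mx g 0 0) gb mxE.
  pose a : cochain G R s := coboundary [ffun v => g 0 (idx v) : K^o].
  have aH : a \in H.
    apply/H_eq; split; first by apply/im_dP; eexists.
    by move=> j; rewrite pairing_coboundary gc mxE.
  pose u := \row_l coord al l a.
  suff -> : g = u *m phi by exact: submxMl.
  have [t ht] : exists t, g = u *m phi + const_mx t.
    apply: coboundary_eq => e; rewrite mulphi.
    have -> : \sum_l u 0 l *: al`_l = a.
      rewrite [RHS](basis_sum al_basis aH).
      by apply: eq_bigr => l _; rewrite mxE.
    by rewrite !ffunE.
  have := congr1 (fun A => (A *m base_mx) 0 0) ht.
  move: phiM; rewrite mul_mx_row -row_mx0 => /eq_row_mx[phib _].
  rewrite mulmxDl -mulmxA phib mulmx0 add0r !mul_base_mx g0 mxE => t0.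
  by rewrite ht -t0; apply/rowP => j; rewrite !mxE addr0.
(* The kernel of [M] has dimension at most [r], so its rank is at least [1 + k]. *)
have fullM : row_full M.
  rewrite /row_full eqn_leq rank_leq_col /=.
  have := mxrankS kerM; rewrite mxrank_ker => h.
  have := leq_trans h (rank_leq_row phi).
  by rewrite leq_subLR [X in (_ <= X)%N]addnC leq_add2l.
have /row_fullP[Z ZM] := fullM.
pose Phi : 'M[K]_N := col_mx phi Z.
have uPhi : Phi \in unitmx.
  rewrite -row_free_unit; apply: inj_row_free => u.
  rewrite -[u]hsubmxK; move: (lsubmx u) (rsubmx u) => {u} u1 u2.
  rewrite mul_row_col => h.
  have := congr1 (mulmx^~ M) h.
  rewrite /= mulmxDl -!mulmxA phiM ZM mulmx0 add0r mulmx1 mul0mx => h2.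
  move: h; rewrite h2 mul0mx addr0 => h1; suff -> : u1 = 0 by rewrite row_mx0.
  have /freeP hfree := basis_free al_basis.
  apply/rowP => l; rewrite mxE; apply: hfree.
  by apply/ffunP => e; rewrite -mulphi h1 !mxE subrr ffunE.
exists (\det Phi); first by rewrite -unitfE -unitmxE.
move=> ed; rewrite -det_mulmx /Phi /form_mx mul_col_row phi_inc -/M phiM ZM.
by rewrite det_lblock det1 mulr1.
Qed.

(** The first [r] rows of the inverse are a left inverse of the incidence matrix; the count of
    components follows from the number of vertices being [r + 1 + k]. *)
Lemma form_mx_unit_forest (Ep : {set E}) (ed : 'I_r -> E) : orientation Ep ->
    (forall j, ed j \in Ep) -> injective ed -> \det (form_mx ed) != 0 ->
  symmetrize [set ed j | j : 'I_r] \in forests G k.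
Proof.
move=> oE edE edI hd; rewrite (forests_incidence vtxK idxK K k oE edE edI).
apply/andP; split; last exact: eqxx.
have uL : form_mx ed \in unitmx by rewrite unitmxE unitfE.
apply/row_fullP; exists (usubmx (invmx (form_mx ed))).
rewrite mul_usub_mx -[X in _ *m X](row_mxKl _ (row_mx base_mx chain_mx)).
rewrite -/(form_mx ed) mulmx_lsub mulVmx //.
by apply/matrixP => i j; rewrite !mxE (inj_eq (@lshift_inj _ _)).
Qed.

End Determinants.

(* The rows of [Psi] form a Z-basis of the 0-cochains adapted to F: functions
   dual to the edges of F, the constant 1, and potentials of the basis of
   B^1(G, F); hence [Psi] is unimodular. *)
Lemma det_form_mx_forest (Ep : {set E}) (ed : 'I_r -> E)
    (b : 'I_k -> {ffun E -> int}) :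
    orientation Ep -> (forall j, ed j \in Ep) -> injective ed ->
    symmetrize [set ed j | j : 'I_r] \in forests G k ->
    is_Zbasis (B1rel (symmetrize [set ed j | j : 'I_r])) b ->
  modulus (\det (form_mx ed)) ^+ 2 = sq_det_pairing b c.
Proof.
move=> oE edE edI; set F := symmetrize _ => hF [bB bspan].
have [g hg] : exists g : 'M[int]_(r, N), g *m inc int ed = 1%:M.
  move: hF; rewrite inE => /and3P[_ /asboolP aF _].
  exact: (acyclic_incidence_linv vtxK idxK oE edE edI int aF).
have /fin_all_exists[f hf] (i : 'I_k) :
    exists f : {ffun vert G -> int}, b i = coboundary f by have [] := bB i.
pose h : 'M[int]_(k, N) := \matrix_(i, l) f i (vtx l).
have hE i e : h i (idx (tgt e)) - h i (idx (src e)) = b i e.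
  by rewrite !mxE !idxK hf ffunE.
pose one : 'rV[int]_N := const_mx 1.
pose Psi : 'M[int]_N := col_mx g (col_mx one h).
(* Subtracting the combination of [g] with the same values on the edges leaves a cochain whose
   coboundary is in B^1(G, F); its expansion in [b] determines it up to a constant. *)
have span (a : 'rV[int]_N) : exists y, y *m Psi = a.
  pose y1 := a *m inc int ed.
  pose a1 := a - y1 *m g.
  have a1I : a1 *m inc int ed = 0.
    by rewrite mulmxBl -mulmxA hg mulmx1 subrr.
  have [n [hn _]] : exists! n : {ffun 'I_k -> int},
      coboundary [ffun v => a1 0 (idx v)] = \sum_(i < k) b i *~ n i.
    apply: bspan; split; first by eexists.
    have hed j : coboundary [ffun v => a1 0 (idx v)] (ed j) = 0.
      by rewrite !ffunE -(mul_incidence vtxK idxK) a1I mxE.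
    move=> e; rewrite in_symmetrize => /orP[] /imsetP[j _ hj].
      by rewrite hj hed.
    have := hed j; rewrite -hj !ffunE src_einv tgt_einv => h0.
    by rewrite -opprB h0 oppr0.
  pose y3 := \row_i n i.
  have [t ht] : exists t, a1 = y3 *m h + const_mx t.
    apply: coboundary_eq => e.
    have := congr1 (fun F : {ffun E -> int} => F e) hn; rewrite !ffunE => ->.
    rewrite sum_ffunE !mxE -sumrB; apply: eq_bigr => i _.
    have ffunMz (u : {ffun E -> int}) (p : int) : (u *~ p) e = u e *~ p.
      by case: p => p; rewrite /intmul ?ffunE ffunMnE.
    by rewrite -mulrBr hE mxE ffunMz mulrzz mulrC.
  exists (row_mx y1 (row_mx (const_mx t) y3)).
  rewrite !mul_row_col.
  have -> : (const_mx t : 'M[int]_1) *m one = const_mx t.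
    by apply/rowP => i; rewrite mxE big_ord1 !mxE mulr1.
  by rewrite [const_mx t + _]addrC -ht addrC subrK.
have [Y YPsi] : exists Y : 'M[int]_N, Y *m Psi = 1%:M.
  have /fin_all_exists[y hy] i := span (row i 1%:M).
  exists (\matrix_i y i); apply/row_matrixP => i.
  by rewrite row_mul rowK.
(* An invertible integer matrix has determinant 1 or -1. *)
have uPsi : (\det Psi) ^+ 2 = 1.
  have := congr1 determinant YPsi; rewrite det_mulmx det1 => hu.
  have : \det Psi \is a GRing.unit by apply/unitrPr; exists (\det Y); rewrite mulrC.
  by rewrite qualifE /= => /orP[] /eqP ->.
pose iK := map_mx (intr : int -> K).
(* Block triangular twice: [one] and [h] have zero coboundary on the edges, and [one] is killed by
   all chains. *)
have PsiL : \det (iK _ _ Psi) * \det (form_mx ed) =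
    \det (\matrix_(i < k, j < k) pairing (extend_scalars R s (b i)) (c j)).
  rewrite -det_mulmx /iK /Psi map_col_mx /form_mx mul_col_row.
  have incK : inc K ed = iK _ _ (inc int ed).
    apply/matrixP => i j; rewrite !mxE rmorphB /=.
    by rewrite !rmorph_nat.
  have -> : map_mx intr g *m inc K ed = 1%:M.
    by rewrite incK -map_mxM hg map_mx1.
  have -> : map_mx intr (col_mx one h) *m inc K ed = 0.
    rewrite incK -map_mxM mul_col_mx.
    have -> : one *m inc int ed = 0.
      apply/matrixP => i j; rewrite (mul_incidence vtxK idxK) !mxE.
      exact: subrr.
    have -> : h *m inc int ed = 0.
      apply/matrixP => i j; rewrite (mul_incidence vtxK idxK) hE mxE.
      by have [_ ->//] := bB i; rewrite in_symmetrize imset_f.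
    by rewrite col_mx0 map_mx0.
  rewrite det_ublock det1 mul1r map_col_mx mul_col_row.
  have -> : map_mx intr one *m base_mx = 1%:M.
    by apply/matrixP => i j; rewrite mul_base_mx !mxE !ord1.
  have -> : map_mx intr one *m chain_mx = 0.
    apply/matrixP => i j; rewrite mul_chain_mx !mxE big1 // => e _.
    by rewrite !mxE subrr mulr0.
  rewrite det_lblock det1 mul1r; congr determinant.
  apply/matrixP => i j; rewrite mul_chain_mx mxE; apply: eq_bigr => e _.
  by rewrite ffunE -hE rmorphB !mxE.
apply: (fmorph_inj (@of_real R s)).
rewrite /sq_det_pairing /= -!conj_scalar_mul -PsiL.
rewrite rmorphM mulrACA /iK det_map_mx /=.
have -> : conj_scalar ((\det Psi)%:~R : K) = (\det Psi)%:~R by exact: rmorph_int.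
by rewrite -rmorphM -expr2 uPsi rmorph1 mul1r.
Qed.

End CutBases.

(** * The law of a determinantal subset *)

Section RandomSubset.
Variables (R : realType) (G : graph) (dT : measure_display).
Variables (T : measurableType dT) (P : probability T R) (Ep : {set edge G}).
Variables (X : T -> {set edge G}) (X_random : random_subset Ep X).
Implicit Type Q : pred {set edge G}.

Lemma random_subset_bigcup Q : [set w | Q (X w)]%classic =
  (\bigcup_(A in [set` enum Q]) [set w | X w = A])%classic.
Proof.
apply/seteqP; split => w /=.
  by move=> Qw; exists (X w) => //=; rewrite mem_enum.
by move=> [A /=]; rewrite mem_enum => QA ->.
Qed.

Lemma measurable_random_subset Q : measurable [set w | Q (X w)]%classic.
Proof.
rewrite random_subset_bigcup; apply: fin_bigcup_measurable => // A _.
exact: X_random.2.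
Qed.

Lemma prob_random_subset Q : P [set w | Q (X w)]%classic =
  (\sum_(A | Q A) fine (P [set w | X w = A]%classic))%:E.
Proof.
rewrite random_subset_bigcup measure_fin_bigcup //.
- rewrite -fsbig_seq ?enum_uniq // big_enum -sumEFin; apply: eq_bigr => A _ /=.
  by rewrite fineK // fin_num_measure //; exact: X_random.2.
- by move=> A B _ _ [w [<- <-]].
- by move=> A _; exact: X_random.2.
Qed.

End RandomSubset.

(* A variable bounded by r with mean r is a.s. equal to r; no Cauchy-Binet
   formula is needed to see that the size is a.s. r. *)
Lemma subset_law_of_size (R : realFieldType) (T : finType) (S : {set T}) (r : nat)
    (p : {set T} -> R) :
  (forall A, 0 <= p A) -> (forall A : {set T}, ~~ (A \subset S) -> p A = 0) ->
  \sum_A p A = 1 ->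
  (forall J : {set T}, J \subset S -> (r < #|J|)%N ->
    \sum_(A : {set T} | J \subset A) p A = 0) ->
  \sum_(e in S) \sum_(A : {set T} | e \in A) p A = r%:R ->
  (forall A : {set T}, #|A| != r -> p A = 0) /\
  (forall J : {set T}, #|J| = r -> p J = \sum_(A : {set T} | J \subset A) p A).
Proof.
move=> p_ge0 p_sub p_sum hgt hmean.
have p_gt (A : {set T}) : (r < #|A|)%N -> p A = 0.
  move=> rA; have [AS|/p_sub//] := boolP (A \subset S).
  have /eqP := hgt A AS rA; rewrite psumr_eq0 => [/allP/(_ A)|B _]; last exact: p_ge0.
  by rewrite mem_index_enum fintype.subxx => /(_ isT)/eqP.
have mean (A : {set T}) : \sum_(e in S) (e \in A)%:R * p A = #|A|%:R * p A.
  have [AS|/p_sub->] := boolP (A \subset S); last first.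
    by rewrite mulr0 big1 // => e _; rewrite mulr0.
  rewrite -mulr_suml; congr (_ * _); rewrite -natr_sum; congr _%:R.
  rewrite -big_mkcondr /= sum1_card; apply: eq_card => e.
  by apply/andb_idl; exact: (fintype.subsetP AS).
(* The mean of [r] minus the size is zero; its terms are nonnegative because larger sets have mass
   zero, so each term vanishes. *)
have sum0 : \sum_(A : {set T}) (r%:R - #|A|%:R) * p A = 0.
  under eq_bigr do rewrite mulrBl -mean.
  rewrite sumrB -mulr_sumr p_sum mulr1 exchange_big -hmean /=.
  apply/eqP; rewrite subr_eq0; apply/eqP; apply: eq_bigr => e _.
  by rewrite big_mkcond; apply: eq_bigr => A _; case: ifP; rewrite ?mul1r ?mul0r.
have p_ne (A : {set T}) : #|A| != r -> p A = 0.
  move=> Ar; have [rA|Ar'] := ltnP r #|A|; first exact: p_gt.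
  move: sum0 => /eqP; rewrite psumr_eq0 => [|B _].
    move=> /allP/(_ A); rewrite mem_index_enum => /(_ isT).
    by rewrite mulf_eq0 subr_eq0 eqr_nat eq_sym (negPf Ar) => /eqP.
  have [/p_gt->|Br] := ltnP r #|B|; first by rewrite mulr0.
  by rewrite mulr_ge0 // subr_ge0 ler_nat.
split=> // J Jr; rewrite (bigD1 J) //= big1 ?addr0 // => A /andP[JA AJ].
apply: p_ne; apply: contraNneq AJ => Ar; rewrite eq_sym eqEcard JA.
by rewrite Ar Jr leqnn.
Qed.

(** Reindexes a minor by ['I_r] instead of ['I_#|J|], so that it matches square matrices of size
    [r]. *)
Lemma principal_minor_onb_mx (R : realType) (s : scalar_kind) (G : graph)
    (Ep J : {set edge G}) (x : edge G -> R) (Pi : 'End(cochain G R s)) r :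
  #|J| = r -> exists ed : 'I_r -> edge G,
    [/\ forall j, ed j \in J, injective ed, [set ed j | j : 'I_r] = J
      & principal_minor Ep x Pi J = \det (onb_mx Ep x Pi ed)].
Proof.
move=> <-; exists enum_val; split => //.
- exact: enum_valP.
- exact: enum_val_inj.
apply/setP => e; apply/imsetP/idP => [[j _ ->]|eJ]; first exact: enum_valP.
by exists (enum_rank_in eJ e) => //; rewrite enum_rankK_in.
Qed.

Theorem theorem8p3 (R : realType) (s : scalar_kind)
    (G : graph) (G_connected : connected_graph G)
    (Ep : {set edge G}) (Ep_orientation : orientation Ep)
    (x : edge G -> R) (x_gt0 : forall e, 0 < x e)
    (x_inv : forall e, x (einv e) = x e)
    (k : nat) (H : {vspace cochain G R s})
    (H_sub : (H <= im_d G R s)%VS)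
    (H_dim : (\dim H)%:Z = #|vert G|%:Z - 1 - k%:Z)
    (c : 'I_k -> chain G R s)
    (H_eq : forall a : cochain G R s,
       a \in H <-> a \in im_d G R s /\ forall j, pairing a (c j) = 0)
    (b : {set edge G} -> 'I_k -> {ffun edge G -> int})
    (b_basis : forall F, F \in forests G k -> is_Zbasis (B1rel F) (b F))
    (dT : measure_display) (T : measurableType dT) (P : probability T R)
    (X : T -> {set edge G}) (X_det : determinantal Ep x H P X) :
  {ae P, forall w, symmetrize (X w) \in forests G k} /\
  (forall F, F \in forests G k ->
     P [set w | symmetrize (X w) = F]%classic =
     (sq_det_pairing (b F) c * weight Ep x F / A_poly Ep x b c)%:E).
Proof.
have [X_rand [Pi Pi_proj Pi_minor]] := X_det.
have [X_sub _] := X_rand.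
pose r := \dim H; pose al := vbasis H.
have al_basis : basis_of H al := vbasisP H.
have hN : #|vert G| = (r + (1 + k))%N.
  suff [] : Posz #|vert G| = Posz (r + (1 + k)) by [].
  by rewrite !PoszD H_dim [Posz 1 + _]addrC addrA !subrK.
pose vtx i := enum_val (cast_ord (esym hN) i) : vert G.
pose idx v := cast_ord hN (enum_rank v).
have vtxK : cancel vtx idx.
  by move=> i; rewrite /idx /vtx enum_valK cast_ordKV.
have idxK : cancel idx vtx.
  by move=> v; rewrite /idx /vtx cast_ordK enum_rankK.
(* The summand 1 in [r + (1 + k)] provides a base vertex. *)
pose v0 := vtx (rshift r (lshift k ord0)).
have H_Omega1 a : a \in H -> Omega1 a.
  move=> /(subvP H_sub) /im_dP[f ->] e.
  by rewrite !ffunE src_einv tgt_einv opprB.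
pose p A := fine (P [set w | X w = A]%classic).
have prQ Q := prob_random_subset P X_rand Q.
have p_sup (J : {set edge G}) : J \subset Ep ->
    of_real s (\sum_(A : {set edge G} | J \subset A) p A) = principal_minor Ep x Pi J.
  by move=> JE; rewrite -Pi_minor // (prQ (fun A : {set edge G} => J \subset A)).
have p_ge0 A : 0 <= p A by rewrite fine_ge0.
have p_sum1 : \sum_A p A = 1.
  have := prQ predT.
  have -> : [set w | predT (X w)]%classic = setT by apply/seteqP; split.
  by rewrite probability_setT => -[].
have p_sub (A : {set edge G}) : ~~ (A \subset Ep) -> p A = 0.
  move=> AE; rewrite /p; have -> : [set w | X w = A]%classic = set0.
    by apply/seteqP; split => w //= h; move: (X_sub w); rewrite h (negPf AE).
  by rewrite measure0.
have p_gt (J : {set edge G}) : J \subset Ep -> (r < #|J|)%N ->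
    \sum_(A : {set edge G} | J \subset A) p A = 0.
  move=> JE rJ; apply: (fmorph_inj (@of_real R s)); rewrite /= p_sup // rmorph0.
  have [ed [edJ _ _ ->]] := principal_minor_onb_mx Ep x Pi (erefl #|J|).
  apply: (det_onb_mx_gt Ep_orientation x_gt0 H_Omega1 Pi_proj al_basis) rJ.
  by move=> j; apply: (fintype.subsetP JE).
(* The inclusion probabilities of single edges are the diagonal entries of the projection, whose
   trace is [r]. *)
have p_mean : \sum_(e in Ep) \sum_(A : {set edge G} | e \in A) p A = r%:R.
  apply: (fmorph_inj (@of_real R s)); rewrite rmorph_sum rmorph_nat.
  have [ed [edE edI im_ed _]] := principal_minor_onb_mx Ep x Pi (erefl #|Ep|).
  rewrite -(trace_onb_mx Ep_orientation x_gt0 H_Omega1 Pi_proj al_basis edE edI);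
    last first.
    move=> e eE; have /imsetP[j _ ->] : e \in [set ed j | j : 'I_#|Ep|].
      by rewrite im_ed.
    by exists j.
  rewrite (eq_bigl (fun e => e \in [set ed j | j : 'I_#|Ep|])); last by rewrite im_ed.
  rewrite big_imset /=; last by move=> ? ? _ _; exact: edI.
  apply: eq_bigr => j _.
  have -> : \sum_(A : {set edge G} | ed j \in A) p A =
      \sum_(A : {set edge G} | [set ed j] \subset A) p A.
    by apply: eq_bigl => A; rewrite finset.sub1set.
  rewrite p_sup ?finset.sub1set //.
  have [f [fJ _ _ ->]] := principal_minor_onb_mx Ep x Pi (cards1 (ed j)).
  by rewrite det_mx11 !mxE; have := fJ 0; rewrite inE => /eqP ->.
have [p_ne p_eq] := subset_law_of_size p_ge0 p_sub p_sum1 p_gt p_mean.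
have gU : \det (gram Ep x al) != 0.
  by rewrite -unitfE -unitmxE (gram_unit Ep_orientation x_gt0 H_Omega1 al_basis).
have [D D0 detD] := det_form_mx G_connected v0 vtxK idxK al_basis H_sub H_eq.
pose q F := sq_det_pairing (b F) c * weight Ep x F.
(* For a set of size [r] the point mass equals the inclusion probability, hence a minor. *)
have p_det (J : {set edge G}) (ed : 'I_r -> edge G) : J \subset Ep ->
    (forall j, ed j \in J) -> injective ed -> [set ed j | j : 'I_r] = J ->
    principal_minor Ep x Pi J = \det (onb_mx Ep x Pi ed) ->
    of_real s (p J) * \det (gram Ep x al) = of_real s (modulus D ^+ 2) *
     of_real s ((\prod_(e in J) x e) * modulus (\det (form_mx vtx v0 c ed)) ^+ 2).
  move=> JE edJ edI im_ed minorJ.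
  have Jr : #|J| = r by rewrite -im_ed card_imset // card_ord.
  rewrite p_eq // p_sup // minorJ.
  rewrite (det_onb_mx Ep_orientation x_gt0 H_Omega1 Pi_proj al_basis); last first.
    by move=> j; apply: (fintype.subsetP JE).
  rewrite -detD -{1}im_ed big_imset /=; last by move=> ? ? _ _; exact: edI.
  by rewrite modulus_sqrM mulrCA rmorphM.
have p_forest F : F \in forests G k ->
    of_real s (p (F :&: Ep)) * \det (gram Ep x al) =
      of_real s (modulus D ^+ 2) * of_real s (q F).
  move=> hF; have sF : is_subgraph F by move: hF; rewrite inE => /and3P[].
  pose J := F :&: Ep.
  have JE : J \subset Ep by exact: subsetIr.
  have symJ : symmetrize J = F by exact: symmetrize_setI.
  (* A forest with [k + 1] components on [r + 1 + k] vertices has [r] edges. *)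
  have Jr : #|J| = r.
    have [ed [edJ edI im_ed _]] := principal_minor_onb_mx Ep x Pi (erefl #|J|).
    have edE j : ed j \in Ep by apply: (fintype.subsetP JE).
    have := forests_incidence vtxK idxK (scalars R s) k Ep_orientation edE edI.
    by rewrite im_ed symJ hF => /esym/andP[_]; rewrite eqn_add2r => /eqP.
  have [ed [edJ edI im_ed minorJ]] := principal_minor_onb_mx Ep x Pi Jr.
  have edE j : ed j \in Ep by apply: (fintype.subsetP JE).
  rewrite (p_det J ed) //; congr (_ * of_real s _); rewrite mulrC; congr (_ * _).
    apply: (det_form_mx_forest G_connected v0 vtxK idxK c Ep_orientation edE edI);
      rewrite im_ed symJ //.
    exact: b_basis.
  by rewrite /weight symmetrize_id.
have p_nforest (J : {set edge G}) :
    J \subset Ep -> symmetrize J \notin forests G k -> p J = 0.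
  move=> JE hJ; have [Jr|/p_ne//] := eqVneq #|J| r.
  have [ed [edJ edI im_ed minorJ]] := principal_minor_onb_mx Ep x Pi Jr.
  have edE j : ed j \in Ep by apply: (fintype.subsetP JE).
  have [det0|det0] := eqVneq (\det (form_mx vtx v0 c ed)) 0; last first.
    have := form_mx_unit_forest vtxK idxK Ep_orientation edE edI det0.
    by rewrite im_ed (negPf hJ).
  have := p_det J ed JE edJ edI im_ed minorJ.
  rewrite det0 modulus_sqr0 mulr0 rmorph0 mulr0 => /eqP.
  by rewrite mulf_eq0 (negPf gU) orbF fmorph_eq0 => /eqP.
have pF F : F \in forests G k ->
    P [set w | symmetrize (X w) = F]%classic = (p (F :&: Ep))%:E.
  move=> hF; have sF : is_subgraph F by move: hF; rewrite inE => /and3P[].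
  rewrite /p fineK ?fin_num_measure //; last exact: X_rand.2.
  congr (P _); apply/seteqP; split => w /= => [<-|->].
    by rewrite symmetrizeK.
  exact: symmetrize_setI.
have p_nsum : \sum_(A | symmetrize A \notin forests G k) p A = 0.
  rewrite big1 // => A hA; have [AE|/p_sub//] := boolP (A \subset Ep).
  exact: p_nforest.
split.
  exists [set w | symmetrize (X w) \notin forests G k]%classic; split.
  - exact: (measurable_random_subset X_rand (fun A => symmetrize A \notin forests G k)).
  - by rewrite (prQ (fun A => symmetrize A \notin forests G k)) p_nsum.
  - by move=> w /= /negP.
have p_fsum : \sum_(F in forests G k) p (F :&: Ep) = 1.
  rewrite -p_sum1 [RHS](bigID (fun A => symmetrize A \in forests G k)) /= p_nsum addr0.
  rewrite [RHS](bigID (fun A : {set edge G} => A \subset Ep)) /=.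
  rewrite [X in _ = _ + X]big1 ?addr0; last first.
    by move=> A /andP[_ /p_sub].
  (* Subgraphs correspond to subsets of [Ep] by intersection, with inverse [symmetrize]. *)
  rewrite [RHS](reindex_onto (fun F => F :&: Ep) (@symmetrize G)) /=; last first.
    by move=> A /andP[_ AE]; exact: symmetrizeK.
  apply: eq_bigl => F; rewrite subsetIr andbT; apply/idP/andP.
    move=> hF; have sF : is_subgraph F by move: hF; rewrite inE => /and3P[].
    by rewrite symmetrize_setI.
  by move=> [+ /eqP h]; rewrite h.
(* Total mass 1 on forests determines the constant; as [gram] is invertible, the normalizing sum is
   nonzero. *)
have gA : \det (gram Ep x al) = of_real s (modulus D ^+ 2) * of_real s (A_poly Ep x b c).
  rewrite -[LHS]mul1r -(rmorph1 (@of_real R s)) -p_fsum rmorph_sum mulr_suml.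
  rewrite rmorph_sum mulr_sumr; apply: eq_bigr => F hF; exact: p_forest.
have [M0 A0] : modulus D ^+ 2 != 0 /\ A_poly Ep x b c != 0.
  by move: gU; rewrite gA mulf_eq0 !fmorph_eq0 negb_or => /andP[].
move=> F hF; rewrite pF //; congr (_%:E).
apply: (mulIf A0); rewrite divfK //; apply: (fmorph_inj (@of_real R s)).
apply: (mulfI (_ : of_real s (modulus D ^+ 2) != 0)); first by rewrite fmorph_eq0.
by rewrite -/(q F) -p_forest // gA (rmorphM _ (p _)) mulrCA.
Qed.
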